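(* If $A$ is a minimally nonideal clutter matrix whose core is the point-line incidence matrix of the Fano plane $\mathrm{PG}(2,2)$, then $A$ is square.
   Context: A clutter $\mathcal{C}=(V,E)$ is a finite set $V$ with a family $E$ of subsets of $V$ (hyperedges) none containing another; its clutter matrix has a row for each hyperedge (its incidence vector) and a column for each vertex. $\mathcal{C}$ (or its matrix $A$, of size $m\times n$) is ideal if the polyhedron $\{x\in\mathbb{R}^n: Ax\ge\mathbf{1},\ x\ge\mathbf{0}\}$ has only integral vertices. Deletion $\mathcal{C}\backslash v$: vertex set $V\setminus\{v\}$, hyperedges those of $\mathcal{C}$ not containing $v$. Contraction $\mathcal{C}/v$: vertex set $V\setminus\{v\}$, hyperedges the inclusion-minimal sets $H\setminus\{v\}$, $H\in E$. Minors are obtained by sequences of deletions and contractions. $\mathcal{C}$ is minimally nonideal if it is not ideal but every proper minor is ideal. The core of $A$ is the submatrix formed by its rows of minimum weight (number of ones); ''the core is the point-line incidence matrix of a projective plane'' means the vertices are the points and the minimum-cardinality hyperedges are exactly the lines. *)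

(* Defs.v *)
From Stdlib Require Import Relation_Operators.
From HB Require Import structures.
From mathcomp Require Import all_boot all_order all_algebra.
From mathcomp Require Import reals.

Set Implicit Arguments.
Unset Strict Implicit.
Unset Printing Implicit Defensive.

Import Order.TTheory GRing.Theory Num.Theory.
Local Open Scope ring_scope.

(* The vertex set is a subset of an ambient finite type, so that a clutter and
   its minors live in the same type. *)
Record clutter (T : finType) := Clutter {
  vtx : {set T};
  hyp : {set {set T}};
  hyp_sub : forall H, H \in hyp -> H \subset vtx;
  hyp_anti : forall H K, H \in hyp -> K \in hyp -> H \subset K -> H = K
}.

Section Minors.
Variable T : finType.
Implicit Types (C D : clutter T) (v : T).

Definition del_hyp C v : {set {set T}} := [set H in hyp C | v \notin H].

Fact del_hyp_sub C v H : H \in del_hyp C v -> H \subset vtx C :\ v.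
Proof.
by rewrite inE => /andP[/hyp_sub sH vH]; rewrite subsetD1 sH vH.
Qed.

Fact del_hyp_anti C v H K :
  H \in del_hyp C v -> K \in del_hyp C v -> H \subset K -> H = K.
Proof. by rewrite !inE => /andP[CH _] /andP[CK _]; apply: hyp_anti CH CK. Qed.

Definition deletion C v : clutter T :=
  Clutter (@del_hyp_sub C v) (@del_hyp_anti C v).

Definition contr_hyp C v : {set {set T}} :=
  [set K | minset (mem [set H :\ v | H in hyp C]) K].

Fact contr_hyp_sub C v K : K \in contr_hyp C v -> K \subset vtx C :\ v.
Proof.
by rewrite inE => /minsetp /imsetP[H /hyp_sub sH ->]; apply: setSD.
Qed.

Fact contr_hyp_anti C v H K :
  H \in contr_hyp C v -> K \in contr_hyp C v -> H \subset K -> H = K.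
Proof. by rewrite !inE => /minsetp CH /minsetinf; apply. Qed.

Definition contraction C v : clutter T :=
  Clutter (@contr_hyp_sub C v) (@contr_hyp_anti C v).

Definition minor_step C D : Prop :=
  exists2 v, v \in vtx C & D = deletion C v \/ D = contraction C v.

Definition proper_minor : clutter T -> clutter T -> Prop :=
  clos_trans (clutter T) minor_step.

End Minors.

Section Ideal.
Variable R : realType.

Definition polyhedron m n (A : 'M[R]_(m, n)) (x : 'cV[R]_n) : Prop :=
  (forall i, 1 <= (A *m x) i 0) /\ (forall j, 0 <= x j 0).

(* A vertex of a polyhedron is an extreme point: a point of P that lies in no
   open segment with distinct endpoints in P. *)
Definition is_vertex n (P : 'cV[R]_n -> Prop) (x : 'cV[R]_n) : Prop :=
  P x /\
  forall (y z : 'cV[R]_n) (t : R), P y -> P z -> 0 < t < 1 ->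
    x = t *: y + (1 - t) *: z -> y = z.

Definition ideal_mx m n (A : 'M[R]_(m, n)) : Prop :=
  forall x, is_vertex (polyhedron A) x -> forall j, x j 0 \is a Num.int.

(* A is a clutter matrix of C, with rows and columns in an arbitrary order. *)
Definition clutter_matrix (T : finType) (C : clutter T) m n
    (A : 'M[R]_(m, n)) : Prop :=
  exists (r : 'I_m -> {set T}) (c : 'I_n -> T),
    [/\ injective r, [set r i | i : 'I_m] = hyp C,
        injective c, [set c j | j : 'I_n] = vtx C &
        forall i j, A i j = (c j \in r i)%:R].

Definition clutter_mx (T : finType) (C : clutter T) :
    'M[R]_(#|hyp C|, #|vtx C|) :=
  \matrix_(i < #|hyp C|, j < #|vtx C|)
    ((enum_val j : T) \in (enum_val i : {set T}))%:R.

Fact clutter_mxP (T : finType) (C : clutter T) :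
  clutter_matrix C (clutter_mx C).
Proof.
exists (@enum_val _ (mem (hyp C))), (@enum_val _ (mem (vtx C))).
split; try exact: enum_val_inj.
- apply/setP=> H; apply/imsetP/idP => [[i _ ->]|CH]; first exact: enum_valP.
  by exists (enum_rank_in CH H); rewrite ?enum_rankK_in.
- apply/setP=> v; apply/imsetP/idP => [[i _ ->]|Cv]; first exact: enum_valP.
  by exists (enum_rank_in Cv v); rewrite ?enum_rankK_in.
- by move=> i j; rewrite mxE.
Qed.

(* Permuting rows and columns preserves [ideal_mx], so the enumeration order
   used by [clutter_mx] is immaterial. *)
Definition ideal (T : finType) (C : clutter T) : Prop :=
  ideal_mx (clutter_mx C).

Definition minimally_nonideal (T : finType) (C : clutter T) : Prop :=
  ~ ideal C /\ forall D, proper_minor C D -> ideal D.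

Definition row_weight m n (A : 'M[R]_(m, n)) (i : 'I_m) : nat :=
  #|[set j | A i j == 1]|.

Definition core_rows m n (A : 'M[R]_(m, n)) : {set 'I_m} :=
  [set i | [forall k, (row_weight A i <= row_weight A k)%N]].

Definition core m n (A : 'M[R]_(m, n)) : 'M[R]_(#|core_rows A|, n) :=
  rowsub (fun i : 'I_#|core_rows A| => enum_val i) A.

(* M is a point-line incidence matrix of PG(2, F): the columns enumerate the
   points (lines through 0 in F^3) and the rows the lines (planes through 0),
   each exactly once. *)
Definition PG2_incidence (F : finFieldType) m n (M : 'M[R]_(m, n)) : Prop :=
  exists (l : 'I_m -> {vspace 'rV[F]_3}) (p : 'I_n -> {vspace 'rV[F]_3}),
    [/\ injective l, forall U, (exists i, l i = U) <-> \dim U = 2%N,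
        injective p, forall U, (exists j, p j = U) <-> \dim U = 1%N &
        forall i j, M i j = (p j <= l i)%VS%:R].

End Ideal.

(* Main.v *)
(* In the Fano plane a set of at least four points containing no line is an
   oval, the complement of a line.  If such an oval {a, b, c, a+b+c} were a
   hyperedge, deleting the points a+b and a+c and contracting a and b would
   leave the triangle on b+c, c and a+b+c, whose polyhedron has the vertex
   (1/2, 1/2, 1/2).  So every hyperedge is a line, and there are as many lines
   as points. *)

From Stdlib Require Import Relation_Operators.
Require Import Defs.
From mathcomp Require Import all_boot all_order all_algebra.
From mathcomp Require Import reals zify lra.

Set Implicit Arguments.
Unset Strict Implicit.
Unset Printing Implicit Defensive.

Import Order.TTheory GRing.Theory Num.Theory.
Local Open Scope ring_scope.

(** * The half-integral vertex of the triangle *)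

Lemma clutter_mx_mulE (R : realType) (T : finType) (C : clutter T)
    (x : 'cV[R]_#|vtx C|) (g : T -> R) i :
  (forall j, x j 0 = g (enum_val j)) ->
  (clutter_mx R C *m x) i 0 = \sum_(v in enum_val i) g v.
Proof.
move=> xg; rewrite mxE.
transitivity (\sum_(j < #|vtx C|)
    (if enum_val j \in (enum_val i : {set T}) then g (enum_val j) else 0)).
  by apply: eq_bigr => j _; rewrite mxE xg; case: ifP; rewrite ?mul1r ?mul0r.
rewrite -(big_enum_val
  (fun v => if v \in (enum_val i : {set T}) then g v else 0)).
rewrite -big_mkcondr; apply: eq_bigl => v.
by rewrite andb_idl // => /(subsetP (hyp_sub (enum_valP i))).
Qed.

(** The three edge constraints are tight at the point with all coordinates 1/2. They are then tight
    at both ends of any open segment of the polyhedron through it, and the three equations have a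
    unique solution. *)
Lemma triangle_nonideal (R : realType) (T : finType) (D : clutter T) p q r :
  p != q -> q != r -> p != r ->
  vtx D = [set p; q; r] ->
  hyp D = [set [set p; q]; [set p; r]; [set q; r]] ->
  ~ ideal R D.
Proof.
move=> pq qr pr vD hD idD.
have pV : p \in vtx D by rewrite vD !inE eqxx.
have qV : q \in vtx D by rewrite vD !inE eqxx orbT.
have rV : r \in vtx D by rewrite vD !inE eqxx !orbT.
have rowE H : H \in hyp D -> exists i : 'I_#|hyp D|, enum_val i = H.
  by move=> HD; exists (enum_rank_in HD H); rewrite enum_rankK_in.
have colE u : u \in vtx D -> exists j : 'I_#|vtx D|, enum_val j = u.
  by move=> uD; exists (enum_rank_in uD u); rewrite enum_rankK_in.
have [jp jpE] := colE p pV; have [jq jqE] := colE q qV.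
have [jr jrE] := colE r rV.
have sum2 (g : T -> R) u v : u != v -> \sum_(w in [set u; v]) g w = g u + g v.
  by move=> uv; rewrite big_setU1 ?inE // big_set1.
have sums (y : 'cV[R]_#|vtx D|) : polyhedron (clutter_mx R D) y ->
    [/\ 1 <= y jp 0 + y jq 0, 1 <= y jp 0 + y jr 0 & 1 <= y jq 0 + y jr 0].
  case=> Py _; pose g u := y (enum_rank_in pV u) 0.
  have yg j : y j 0 = g (enum_val j) by rewrite /g enum_valK_in.
  have pairE u v : u != v -> [set u; v] \in hyp D -> 1 <= g u + g v.
    move=> uv /rowE[i iE]; have := Py i.
    by rewrite (clutter_mx_mulE _ yg) iE sum2.
  by rewrite !yg jpE jqE jrE; split; apply: pairE; rewrite // hD !inE eqxx ?orbT.
have colP j : [\/ j = jp, j = jq | j = jr].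
  have := enum_valP j; rewrite {2}vD !inE -orbA => /or3P[] /eqP jE;
  [constructor 1|constructor 2|constructor 3]; apply: enum_val_inj;
  by rewrite jE.
pose h : 'cV[R]_#|vtx D| := const_mx 2^-1.
have hv : is_vertex (polyhedron (clutter_mx R D)) h.
  split.
    split=> [i|j]; last by rewrite mxE invr_ge0 ler0n.
    rewrite (@clutter_mx_mulE _ _ _ _ (fun=> 2^-1)); last by move=> j; rewrite mxE.
    have := enum_valP i; rewrite {2}hD !inE -orbA => /or3P[] /eqP ->;
    by rewrite sum2 //; lra.
  move=> y z t /sums[y1 y2 y3] /sums[z1 z2 z3] /andP[t0 t1] hE.
  have E j : 2^-1 = t * y j 0 + (1 - t) * z j 0.
    by have := congr1 (fun M : 'cV_ _ => M j 0) hE; rewrite !mxE.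
  have tight u v : 1 <= u -> 1 <= v -> t * u + (1 - t) * v = 1 -> u = 1 /\ v = 1.
    by move=> u1 v1 e; split; nra.
  have [a1 b1] := tight _ _ y1 z1 ltac:(move: (E jp) (E jq); lra).
  have [a2 b2] := tight _ _ y2 z2 ltac:(move: (E jp) (E jr); lra).
  have [a3 b3] := tight _ _ y3 z3 ltac:(move: (E jq) (E jr); lra).
  apply/matrixP=> j k; rewrite (ord1 k).
  by case: (colP j) => ->; lra.
have := idD h hv jp; rewrite mxE => /intrP[k kE].
have : (2 * k)%:~R = 1%:~R :> R by rewrite intrM -kE divff // pnatr_eq0.
by move/intr_inj; lia.
Qed.

(** * Triangle minors, with tools for finite sets *)

(** In an antichain every member is minimal, so the contraction discards nothing. *)
Lemma contr_hyp_eq (T : finType) (C : clutter T) v (E : {set {set T}}) :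
  [set H :\ v | H in hyp C] = E ->
  {in E &, forall H K : {set T}, H \subset K -> H = K} ->
  hyp (contraction C v) = E.
Proof.
move=> hE anti; apply/setP=> K; rewrite inE /= hE.
apply/minsetP/idP => [[]//|KE]; split=> // H HE; exact: anti.
Qed.

Lemma card_set3_le (T : finType) (a b c : T) : (#|[set a; b; c]| <= 3)%N.
Proof.
rewrite setUC; apply: leq_trans (leq_card_setU _ _) _.
by rewrite cards1 cards2; case: eqP.
Qed.

Lemma card_offdiag (T : finType) (A : {set T}) :
  #|[set st : T * T | [&& st.1 \in A, st.2 \in A & st.1 != st.2]]| =
  (#|A| * #|A|.-1)%N.
Proof.
rewrite -sum1_card; transitivity (\sum_(s in A) \sum_(t in A :\ s) 1)%N.
  rewrite pair_big_dep /=; apply: eq_bigl => st; rewrite !inE.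
  by rewrite [st.2 == _]eq_sym [(st.2 \in A) && _]andbC.
rewrite -sum_nat_const; apply: eq_bigr => s sA.
by rewrite sum1_card (cardsD1 s A) sA.
Qed.

Local Notation neq2 u v := (((u == v) = false) * ((v == u) = false))%type.

(** Kept in both orientations, the inequalities form one multirule that decides every equality test
    between two of the seven points. *)
Lemma uniq7_neqE (T : eqType) (a b c d x y z : T) :
  uniq [:: a; b; c; d; x; y; z] ->
  (neq2 a b * neq2 a c * neq2 a d * neq2 a x * neq2 a y *
   neq2 a z * neq2 b c * neq2 b d * neq2 b x * neq2 b y *
   neq2 b z * neq2 c d * neq2 c x * neq2 c y * neq2 c z *
   neq2 d x * neq2 d y * neq2 d z * neq2 x y * neq2 x z *
   neq2 y z)%type.
Proof.
have neq u v : u != v -> neq2 u v.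
  by move=> uv; rewrite [v == u]eq_sym (negbTE uv).
rewrite /= !inE !negb_or -!andbA.
move=> /and5P[/neq ab /neq ac /neq ad /neq ax].
move=> /and5P[/neq ay /neq az /neq bc /neq bd].
move=> /and5P[/neq bx /neq b_y /neq bz /neq cd].
move=> /and5P[/neq cx /neq cy /neq cz /neq dx].
move=> /and5P[/neq dy /neq dz /neq xy /neq xz /andP[/neq yz _]].
by do !split; rewrite ?(ab, ac, ad, ax, ay, az, bc, bd, bx, b_y, bz,
  cd, cx, cy, cz, dx, dy, dz, xy, xz, yz).
Qed.

(** In the application x = a+b, y = b+c, z = a+c and d = a+b+c. Once [x] and [z] are deleted,
    contracting [a] leaves ybc, yd, bcd, and contracting [b] leaves the triangle yc, yd, cd; both
    families are antichains. *)
Lemma triangle_minor (R : realType) (T : finType) (C : clutter T)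
    a b c d x y z :
  uniq [:: a; b; c; d; x; y; z] ->
  vtx C =i [:: a; b; c; d; x; y; z] ->
  [set H in hyp C | (x \notin H) && (z \notin H)] =
    [set [set y; b; c]; [set y; a; d]; [set a; b; c; d]] ->
  exists2 D, proper_minor C D & ~ ideal R D.
Proof.
move=> Us Vs hC.
have neqE := uniq7_neqE Us.
pose C2 := deletion (deletion C x) z.
pose C3 := contraction C2 a; pose D := contraction C3 b.
have hC2 : hyp C2 = [set [set y; b; c]; [set y; a; d]; [set a; b; c; d]].
  by rewrite -hC; apply/setP=> H; rewrite !inE andbA.
have hC3 : hyp C3 = [set [set y; b; c]; [set y; d]; [set b; c; d]].
  apply: contr_hyp_eq.
    rewrite hC2 !imsetU !imset_set1; congr [set _; _; _]; apply/setP=> t;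
    rewrite !inE;
    by do ![case: (t =P _) => [->|_]]; rewrite ?eqxx ?neqE.
  move=> H K; rewrite !inE -!orbA => /or3P[] /eqP-> /or3P[] /eqP->;
  by rewrite ?subUset ?sub1set ?inE ?eqxx ?neqE.
have hD : hyp D = [set [set y; c]; [set y; d]; [set c; d]].
  apply: contr_hyp_eq.
    rewrite hC3 !imsetU !imset_set1; congr [set _; _; _]; apply/setP=> t;
    rewrite !inE;
    by do ![case: (t =P _) => [->|_]]; rewrite ?eqxx ?neqE.
  move=> H K; rewrite !inE -!orbA => /or3P[] /eqP-> /or3P[] /eqP->;
  by rewrite ?subUset ?sub1set ?inE ?eqxx ?neqE.
exists D.
  have delS E v : v \in vtx E -> proper_minor E (deletion E v).
    by move=> vE; apply: t_step; exists v => //; left.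
  have conS E v : v \in vtx E -> proper_minor E (contraction E v).
    by move=> vE; apply: t_step; exists v => //; right.
  apply: (@t_trans _ _ _ (deletion C x)).
    by apply: delS; rewrite Vs !inE eqxx !orbT.
  apply: (@t_trans _ _ _ C2).
    by apply: delS; rewrite !inE Vs !inE eqxx ?neqE !orbT.
  apply: (@t_trans _ _ _ C3).
    by apply: conS; rewrite !inE Vs !inE eqxx ?neqE.
  by apply: conS; rewrite !inE Vs !inE eqxx ?neqE !orbT.
apply: (triangle_nonideal _ _ _ _ hD); rewrite ?neqE //.
apply/setP=> t; rewrite !inE Vs !inE.
by do ![case: (t =P _) => [->|_]]; rewrite ?eqxx ?neqE ?orbT /= ?orbF.
Qed.

(** * The Fano plane in bit coordinates *)

(** Addition in F_2^3. Boolean coordinates let claims about vectors be settled by running through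
    all cases. *)
Definition xor3 (u v : bool * bool * bool) : bool * bool * bool :=
  (u.1.1 (+) v.1.1, u.1.2 (+) v.1.2, u.2 (+) v.2).

Definition zero3 : bool * bool * bool := (false, false, false).

Lemma xor3_neq0 u v : u != v -> xor3 u v != zero3.
Proof. by case: u v => [[[] []] []] [[[] []] []]. Qed.

(* Homogeneous coordinates over F_2: a point of the Fano plane is a nonzero
   vector, and the third point of the line through u and v is u + v. *)
Definition fano_labelling (T : finType) (C : clutter T)
    (vec : T -> bool * bool * bool) : Prop :=
  [/\ {in vtx C &, injective vec},
      vec @: vtx C = [set~ zero3],
      {in vtx C & &, forall s t u, s != t ->
        ([set s; t; u] \in hyp C) = (vec u == xor3 (vec s) (vec t))} &
      {in hyp C, forall H : {set T}, 2 < #|H|}%N].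

Section Labelling.
Variables (T : finType) (C : clutter T) (vec : T -> bool * bool * bool).
Hypothesis vecP : fano_labelling C vec.

Lemma card_fano_vtx : #|vtx C| = 7%N.
Proof.
case: vecP => vI vS _ _.
by rewrite -(card_in_imset vI) vS cardsC1 !card_prod card_bool.
Qed.

Lemma fano_vec_neq0 s : s \in vtx C -> vec s != zero3.
Proof.
case: vecP => _ vS _ _ sV.
by have : vec s \in vec @: vtx C by [exact: imset_f]; rewrite vS !inE.
Qed.

Lemma fano_vec_neq s t : s \in vtx C -> t \in vtx C ->
  s != t -> vec s != vec t.
Proof. by case: vecP => vI _ _ _ sV tV; apply: contra_neq; apply: vI. Qed.

Lemma fano_point w : w != zero3 -> exists2 s, s \in vtx C & vec s = w.
Proof.
case: vecP => _ vS _ _ w0; have : w \in vec @: vtx C by rewrite vS !inE.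
by case/imsetP=> s; exists s.
Qed.

Lemma fano_third s t : s \in vtx C -> t \in vtx C -> s != t ->
  exists u, [/\ u \in vtx C, vec u = xor3 (vec s) (vec t) &
                [set s; t; u] \in hyp C].
Proof.
move=> sV tV st; have [u uV uE] := fano_point (xor3_neq0 (fano_vec_neq sV tV st)).
by exists u; split=> //; case: vecP => _ _ -> //; rewrite uE.
Qed.

(* The hyperedges avoiding a+b and a+c are the oval {a, b, c, a+b+c} and the two
   lines through b+c other than {a+b, a+c, b+c}. *)
Lemma fano_oval_minor (R : realType) H :
  H \in hyp C -> (3 < #|H|)%N -> exists2 D, proper_minor C D & ~ ideal R D.
Proof.
move=> CH H4.
have sHV := subsetP (hyp_sub CH).
have /card_gt2P[a [b [c [[aH bH cH] [ab bc ca]]]]] := ltnW H4.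
have [[aV bV] cV] := (sHV a aH, sHV b bH, sHV c cH).
(* A line inside [H] would equal [H] by the antichain property, but [H] has more than three
   points. *)
have third s t u : [set s; t; u] \in hyp C -> s \in H -> t \in H -> u \notin H.
  move=> Cstu sH tH; apply/negP=> uH.
  have /(hyp_anti Cstu CH) stuH : [set s; t; u] \subset H.
    by rewrite !subUset !sub1set sH tH uH.
  by move: H4; rewrite -stuH ltnNge card_set3_le.
(* The vectors of [x], [z], [y] are a+b, c+a, b+c. As third points of lines through two points of
   [H], they lie outside [H]. *)
have [x [xV xE Cabx]] := fano_third aV bV ab.
have [z [zV zE Caz]] := fano_third cV aV ca.
have [y [yV yE Cbcy]] := fano_third bV cV bc.
have xH : x \notin H by apply: third Cabx aH bH.
have zH : z \notin H by apply: third Caz cH aH.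
have yH : y \notin H by apply: third Cbcy bH cH.
have cx : c != x by apply: contraNneq xH => <-.
have [d dV dE] := fano_point (xor3_neq0 (fano_vec_neq cV xV cx)).
(* Distinctness is pulled back from the vectors, where it is a finite check: a, b, c are nonzero and
   distinct, and c is not a+b. *)
have Us : uniq [:: a; b; c; d; x; y; z].
  apply: (@map_uniq _ _ vec); rewrite /= xE yE dE zE xE.
  move: (fano_vec_neq cV xV cx) (fano_vec_neq0 aV) (fano_vec_neq0 bV)
    (fano_vec_neq0 cV) (fano_vec_neq aV bV ab) (fano_vec_neq bV cV bc)
    (fano_vec_neq cV aV ca); rewrite xE.
  by move: (vec a) (vec b) (vec c) => [[[] []] []] [[[] []] []] [[[] []] []].
have Vs : vtx C =i [:: a; b; c; d; x; y; z].
  move=> t; apply/esym; move: t; apply/subset_cardP.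
    by rewrite card_fano_vtx (card_uniqP Us).
  by apply/subsetP=> t; rewrite !inE;
     do ![case/orP=> [/eqP->//|]]; move/eqP->.
apply: (triangle_minor _ Us Vs).
(* [H] misses [x], [y] and [z], and its size then forces equality. *)
have HE : H = [set a; b; c; d].
  apply/eqP; rewrite eqEcard; apply/andP; split; last first.
    apply: leq_trans H4; rewrite setUC; apply: leq_trans (leq_card_setU _ _) _.
    by rewrite cards1 add1n ltnS card_set3_le.
  apply/subsetP=> t tH; move: (sHV t tH); rewrite Vs !inE.
  case/or4P=> [->//|->|->|]; rewrite ?orbT //.
  case/or4P=> [->|/eqP tE|/eqP tE|/eqP tE]; rewrite ?orbT //;
  by move: tH; rewrite tE ?(negbTE xH) ?(negbTE yH) ?(negbTE zH).
have neqE := uniq7_neqE Us.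
have lineE s t u : s \in vtx C -> t \in vtx C -> u \in vtx C -> s != t ->
    ([set s; t; u] \in hyp C) = (vec u == xor3 (vec s) (vec t)).
  by case: vecP => _ _ lineP _ sV tV uV; apply: lineP.
have Cybc : [set y; b; c] \in hyp C.
  rewrite lineE ?neqE // yE.
  by case: (vec b) (vec c) => [[[] []] []] [[[] []] []].
have Cyad : [set y; a; d] \in hyp C.
  rewrite lineE ?neqE // yE dE xE.
  by case: (vec a) (vec b) (vec c) => [[[] []] []] [[[] []] []] [[[] []] []].
apply/setP=> K; rewrite !inE; apply/idP/idP; last first.
  rewrite -orbA => /or3P[] /eqP->; rewrite -?HE ?CH ?Cybc ?Cyad ?xH ?zH //=;
  by rewrite !inE !neqE.
case/and3P=> CK xK zK.
have sKV := subsetP (hyp_sub CK).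
have KP t : t \in K -> [|| t == a, t == b, t == c, t == d | t == y].
  move=> tK; move: (sKV t tK); rewrite Vs !inE.
  by do ![case: (t =P _) => [tE|_] //]; rewrite tE ?(negbTE xK) ?(negbTE zK) in tK.
(* Without [y], [K] lies inside the oval [H] and so equals it. *)
have [yK|yK] := boolP (y \in K); last first.
  rewrite (hyp_anti CK CH) ?HE ?eqxx ?orbT //; apply/subsetP=> t tK.
  rewrite !inE; move: (KP t tK).
  by do ![case: (t =P _) => [tE|_] //]; rewrite tE (negbTE yK) in tK.
have [/andP[bK cK]|bcK] := boolP ((b \in K) && (c \in K)).
  by rewrite -(hyp_anti Cybc CK) ?eqxx // !subUset !sub1set yK bK.
have [/andP[aK dK]|adK] := boolP ((a \in K) && (d \in K)).
  by rewrite -(hyp_anti Cyad CK) ?eqxx ?orbT // !subUset !sub1set yK aK.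
(* Now [K] has at most one of [b], [c] and at most one of [a], [d]. Having at least three points, it
   consists of [y] and one point from each pair. *)
pose s := if b \in K then b else c; pose t := if a \in K then a else d.
have K3 : (2 < #|K|)%N by case: vecP => _ _ _; apply.
have KE : K = [set y; s; t].
  apply/eqP; rewrite eqEcard (leq_trans (card_set3_le _ _ _) K3) andbT.
  apply/subsetP=> u uK; have := KP u uK; rewrite !inE /s /t.
  case/or4P=> [/eqP uE|/eqP uE|/eqP uE|/orP[/eqP uE|->//]]; rewrite uE in uK *.
  - by rewrite uK eqxx !orbT.
  - by rewrite uK eqxx orbT.
  - by rewrite uK andbT in bcK; rewrite (negbTE bcK) eqxx orbT.
  - by rewrite uK andbT in adK; rewrite (negbTE adK) eqxx !orbT.
(* As a hyperedge on three points, [K] is a line, so the vector of [t] is y+s, which is b or c. But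
   it is also a or a+b+c, and these differ from both. *)
move: CK; rewrite KE lineE; last 4 first.
- exact: yV.
- by rewrite /s; case: ifP.
- by rewrite /t; case: ifP.
- by rewrite /s; case: ifP; rewrite neqE.
have sE : (vec s == vec b) || (vec s == vec c).
  by rewrite /s; case: ifP; rewrite eqxx ?orbT.
have tE : (vec t == vec a) || (vec t == vec d).
  by rewrite /t; case: ifP; rewrite eqxx ?orbT.
move=> lE; exfalso; move: lE (fano_vec_neq cV xV cx) (fano_vec_neq0 aV)
  (fano_vec_neq aV bV ab) (fano_vec_neq bV cV bc) (fano_vec_neq cV aV ca).
by case/orP: sE => /eqP->; case/orP: tE => /eqP->; rewrite yE ?dE xE;
   move: (vec a) (vec b) (vec c) => [[[] []] []] [[[] []] []] [[[] []] []].
Qed.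

(** * Counting the lines *)

(** Double count of the ordered pairs of distinct points together with a hyperedge through both.
    Each of the 42 pairs lies in exactly one hyperedge, and each hyperedge carries 6 pairs. *)
Lemma card_fano_lines : {in hyp C, forall H : {set T}, #|H| = 3%N} ->
  #|hyp C| = 7%N.
Proof.
move=> H3.
pose P (st : T * T) (A : {set T}) := [&& st.1 \in A, st.2 \in A & st.1 != st.2].
have : (\sum_(H in hyp C) \sum_(st : T * T) P st H =
        \sum_(st : T * T) P st (vtx C))%N.
  rewrite exchange_big; apply: eq_bigr => -[s t] _.
  have [/and3P[/= sV tV st]|PV] := boolP (P _ _); last first.
    apply: big1 => H CH; apply/eqP; rewrite eqb0; apply: contra PV.
    by case/and3P=> /= sH tH st; rewrite /P /= !(subsetP (hyp_sub CH)).
  have [u [uV uE Cstu]] := fano_third sV tV st.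
  rewrite (bigD1 _ Cstu) /= {1}/P /= !inE !eqxx orbT st /=.
  rewrite big1 // => H /andP[inC HE]; have {inC}CH : H \in hyp C := inC.
  apply/eqP; rewrite eqb0.
  (* Another hyperedge through [s] and [t] has a third point with vector s+t, and this point can
     only be [u]. *)
  apply: contra HE => /and3P[/= sH tH _].
  have : #|H :\ s :\ t| = 1%N.
    have := H3 H CH; rewrite (cardsD1 s) sH (cardsD1 t) !inE eq_sym st tH.
    by case.
  case/eqP/cards1P=> v vE.
  have HE : H = [set s; t; v] by rewrite -setUA -vE !setD1K // !inE eq_sym st.
  have vV : v \in vtx C by apply: (subsetP (hyp_sub CH)); rewrite HE !inE eqxx orbT.
  move: CH; rewrite HE; case: vecP => vI _ -> // _; rewrite -uE => /eqP vu.
  by rewrite (vI _ _ vV uV vu).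
have cardP A : (\sum_(st : T * T) P st A)%N = (#|A| * #|A|.-1)%N.
  rewrite -card_offdiag -sum1_card [RHS]big_mkcond; apply: eq_bigr => st _.
  by rewrite inE /P; case: ifP.
rewrite cardP card_fano_vtx (eq_bigr (fun=> 6%N)); last first.
  by move=> H CH; rewrite cardP H3.
by rewrite sum_nat_const; lia.
Qed.
End Labelling.

(** * Vectors over F_2 and their bits *)

Lemma F2_cases (k : 'F_2) : k = 0 \/ k = 1.
Proof. by case: k => [[|[|//]] lt2]; [left|right]; apply: val_inj. Qed.

Lemma F2_addvv (u : 'rV['F_2]_3) : u + u = 0.
Proof.
by rewrite -mulr2n -scaler_nat (_ : 2%:R = 0) ?scale0r //; apply: val_inj.
Qed.

Lemma F2_span2 (u v w : 'rV['F_2]_3) :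
  w \in (<[u]> + <[v]>)%VS -> [\/ w = 0, w = u, w = v | w = u + v].
Proof.
case/memv_addP=> _ /vlineP[k ->] [_ /vlineP[k' ->] ->].
case: (F2_cases k) (F2_cases k') => -> [] ->; rewrite ?scale0r ?scale1r ?add0r ?addr0.
- by constructor 1.
- by constructor 3.
- by constructor 2.
- by constructor 4.
Qed.

(** Over F_2 the span of a nonzero vector contains no other nonzero vector, so the spans of [u] and
    [v] meet only in 0. *)
Lemma F2_dim_span2 (u v : 'rV['F_2]_3) :
  u != 0 -> v != 0 -> u != v -> \dim (<[u]> + <[v]>)%VS = 2%N.
Proof.
move=> u0 v0 uv; rewrite dimv_disjoint_sum ?dim_vline ?u0 ?v0 //.
apply/eqP; rewrite -subv0; apply/subvP=> w; rewrite memv_cap memv0.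
case/andP=> /vlineP[k ->] /vlineP[k'].
case: (F2_cases k) (F2_cases k') => -> [] ->; rewrite ?scale0r ?scale1r ?eqxx //.
  by move/eqP; rewrite (negbTE u0).
by move/eqP; rewrite (negbTE uv).
Qed.

Definition bits3 (v : 'rV['F_2]_3) : bool * bool * bool :=
  (v 0 (inord 0) == 1, v 0 (inord 1) == 1, v 0 (inord 2) == 1).

Lemma bits3_inj : injective bits3.
Proof.
have F2_eq (k k' : 'F_2) : (k == 1) = (k' == 1) -> k = k'.
  by case: (F2_cases k) (F2_cases k') => -> [] ->.
move=> u v [e0 e1 e2]; apply/rowP=> j; rewrite -(inord_val j).
by case: j => [[|[|[|//]]] lt3] /=; apply: F2_eq.
Qed.

Lemma bits3_surj b : exists v, bits3 v = b.
Proof.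
case: b => [[b0 b1] b2].
exists (\row_(j < 3) (nth false [:: b0; b1; b2] j)%:R).
by rewrite /bits3 !mxE !inordK //=; case: b0 b1 b2 => [] [] [].
Qed.

Lemma bits3D u v : bits3 (u + v) = xor3 (bits3 u) (bits3 v).
Proof.
have F2D (k k' : 'F_2) : (k + k' == 1) = (k == 1) (+) (k' == 1).
  by case: (F2_cases k) (F2_cases k') => -> [] ->.
by rewrite /bits3 !mxE !F2D.
Qed.

Lemma bits30 : bits3 0 = zero3.
Proof. by rewrite /bits3 !mxE. Qed.

(** * The labelling obtained from the core *)

(** A point of PG(2,2) contains a single nonzero vector, whose bits label the vertex; lines become
    triples u, v, u+v. Hence the minimum weight is 3, and every three-point hyperedge is a core row,
    that is, a line. *)
Lemma PG2_fano_labelling (R : realType) (T : finType) (C : clutter T) m n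
    (A : 'M[R]_(m, n)) :
  clutter_matrix C A -> PG2_incidence 'F_2 (core A) ->
  exists vec, fano_labelling C vec.
Proof.
case=> r [c [rI rE cI cE AE]] [l [p [lI lP pI pP ME]]].
pose w j := vpick (p j).
have w0 j : w j != 0.
  by rewrite vpick0 -dimv_eq0 ((pP (p j)).1 (ex_intro _ j erefl)).
have pE j : p j = <[w j]>%VS.
  apply/eqP; rewrite eq_sym eqEdim dim_vline w0 -memvE memv_pick.
  by rewrite ((pP (p j)).1 (ex_intro _ j erefl)).
have wI : injective w by move=> j k jk; apply: pI; rewrite !pE jk.
have wS v : v != 0 -> exists j, w j = v.
  move=> v0; have [j jE] : exists j, p j = <[v]>%VS by apply/pP; rewrite dim_vline v0.
  exists j; have := memv_pick (p j); rewrite {2}jE => /vlineP[k].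
  rewrite -/(w j); case: (F2_cases k) => ->; rewrite ?scale1r // scale0r => wj.
  by have := w0 j; rewrite wj eqxx.
(* [zero3] is only a default outside [vtx C], since every vertex is some [c j]. *)
pose vec t := if [pick j | c j == t] is Some j then bits3 (w j) else zero3.
have vecE j : vec (c j) = bits3 (w j).
  rewrite /vec; case: pickP => [k /eqP/cI -> //|/(_ j)]; by rewrite eqxx.
have vtxP t : t \in vtx C -> exists j, t = c j.
  by rewrite -cE => /imsetP[j]; exists j.
have cV j : c j \in vtx C by rewrite -cE imset_f.
have hypP H : H \in hyp C -> exists i, H = r i.
  by rewrite -rE => /imsetP[i]; exists i.
have rC i : r i \in hyp C by rewrite -rE imset_f.
(* [enum_val] carries a row of the core back to its row of [A]; the 0/1 entries are compared in [R],
   where 0 and 1 differ. *)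
have incE i j : (c j \in r (enum_val i)) = (w j \in l i).
  have := ME i j; rewrite !mxE AE pE -memvE.
  case: (_ \in _); case: (_ \in _) => //= /eqP; first by rewrite oner_eq0.
  by rewrite eq_sym oner_eq0.
have weightE i : row_weight A i = #|r i|.
  rewrite /row_weight -(card_imset _ cI); congr #|pred_of_set _|; apply/setP=> t.
  apply/imsetP/idP => [[j]|tr].
    by rewrite inE AE pnatr_eq1 eqb1 => ? ->.
  have [j tE] := vtxP t (subsetP (hyp_sub (rC i)) t tr).
  by exists j; rewrite // inE AE -tE tr eqxx.
(* The two vectors span the whole line, and over F_2 the only nonzero vectors of the span are the
   two and their sum. *)
have lineE i j1 j2 j3 : j1 != j2 -> w j3 = w j1 + w j2 ->
    w j1 \in l i -> w j2 \in l i -> r (enum_val i) = [set c j1; c j2; c j3].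
  move=> j12 w3 l1 l2.
  have lE : l i = (<[w j1]> + <[w j2]>)%VS.
    apply/eqP; rewrite eq_sym eqEdim subv_add -!memvE l1 l2.
    rewrite F2_dim_span2 ?w0 ?(inj_eq wI) //.
    by rewrite ((lP (l i)).1 (ex_intro _ i erefl)).
  apply/setP=> t; apply/idP/idP => [tr|]; last first.
    rewrite !inE -orbA => /or3P[] /eqP->; rewrite incE // w3.
    exact: rpredD.
  have [j tE] := vtxP t (subsetP (hyp_sub (rC _)) t tr).
  move: tr; rewrite tE incE lE !inE !(inj_eq cI) => /F2_span2[wj|/wI->|/wI->|wj].
  - by have := w0 j; rewrite wj eqxx.
  - by rewrite eqxx.
  - by rewrite eqxx orbT.
  - by rewrite -w3 in wj; rewrite (wI _ _ wj) eqxx !orbT.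
have lineS j1 j2 : j1 != j2 -> exists i, w j1 \in l i /\ w j2 \in l i.
  move=> j12; have [i iE] : exists i, l i = (<[w j1]> + <[w j2]>)%VS.
    by apply/lP; rewrite F2_dim_span2 ?w0 ?(inj_eq wI).
  exists i; rewrite iE; split.
    by apply: (subvP (addvSl _ _)); apply: memv_line.
  by apply: (subvP (addvSr _ _)); apply: memv_line.
have thirdS j1 j2 : j1 != j2 -> exists j3, w j3 = w j1 + w j2.
  move=> j12; apply: wS; apply: contra j12 => /eqP e; apply/eqP/wI.
  by rewrite -[w j1]addr0 -(F2_addvv (w j2)) addrA e add0r.
have third_neq j1 j2 j3 : w j3 = w j1 + w j2 -> (c j3 != c j1) && (c j3 != c j2).
  move=> w3; rewrite !(inj_eq cI); apply/andP; split.
    apply: contra (w0 j2) => /eqP e; move: w3; rewrite e => /eqP.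
    by rewrite -subr_eq0 opprD addrA subrr sub0r oppr_eq0.
  apply: contra (w0 j1) => /eqP e; move: w3; rewrite e => /eqP.
  by rewrite addrC -subr_eq0 opprD addrA subrr sub0r oppr_eq0.
have card_line j1 j2 j3 : j1 != j2 -> w j3 = w j1 + w j2 ->
    #|[set c j1; c j2; c j3]| = 3%N.
  move=> j12 /third_neq/andP[c31 c32].
  by rewrite setUC cardsU1 !inE negb_or c31 c32 cards2 (inj_eq cI) j12.
have core_min i k : k \in core_rows A -> (#|r k| <= #|r i|)%N.
  by rewrite inE => /forallP/(_ i); rewrite !weightE.
(* Two basis vectors provide one actual line; its row shows that the minimum weight is 3. *)
have [j1 [j2 j12]] : exists j1 j2, w j1 != w j2.
  have [u uE] := bits3_surj (true, false, false).
  have [v vE] := bits3_surj (false, true, false).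
  have [|j1 j1E] := wS u; first by apply/eqP=> u0; move: uE; rewrite u0 bits30.
  have [|j2 j2E] := wS v; first by apply/eqP=> v0; move: vE; rewrite v0 bits30.
  by exists j1, j2; rewrite j1E j2E; apply/eqP=> uv; move: uE; rewrite uv vE.
rewrite (inj_eq wI) in j12.
have hyp3 H : H \in hyp C -> (2 < #|H|)%N.
  case/hypP=> i ->; have [i0 [l1 l2]] := lineS _ _ j12.
  have [j3 w3] := thirdS _ _ j12.
  rewrite -(card_line _ _ _ j12 w3) -(lineE _ _ _ _ j12 w3 l1 l2).
  exact/core_min/enum_valP.
exists vec; split=> //.
- move=> s t /vtxP[j ->] /vtxP[k ->]; rewrite !vecE => /bits3_inj/wI -> //.
- apply/setP=> b; rewrite !inE; apply/imsetP/idP => [[t /vtxP[j ->] ->]|b0].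
    by rewrite vecE -bits30 (inj_eq bits3_inj).
  have [v vE] := bits3_surj b.
  have [|j jE] := wS v; first by apply: contra b0 => /eqP v0; rewrite -vE v0 bits30.
  by exists (c j); rewrite ?vecE ?jE.
move=> _ _ _ /vtxP[k1 ->] /vtxP[k2 ->] /vtxP[k3 ->]; rewrite (inj_eq cI) => k12.
have [k3' w3] := thirdS _ _ k12; have [i [l1 l2]] := lineS _ _ k12.
rewrite !vecE -bits3D (inj_eq bits3_inj) -w3 (inj_eq wI).
(* The set has at most three points, so it attains the minimum weight and is a core row. As the line
   through [c k1] and [c k2] it contains [c k3'], which differs from both and so equals [c k3]. *)
apply/idP/eqP => [CH|->]; last by rewrite -(lineE _ _ _ _ k12 w3 l1 l2).
have [i' iE] := hypP _ CH.
have i'core : i' \in core_rows A.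
  rewrite inE; apply/forallP=> k; rewrite !weightE -iE.
  apply: leq_trans (hyp3 _ (rC k)).
  exact: card_set3_le.
have iV : enum_val (enum_rank_in i'core i') = i' by rewrite enum_rankK_in.
have lk k : (w k \in l (enum_rank_in i'core i')) = (c k \in r i').
  by rewrite -incE iV.
have := lineE (enum_rank_in i'core i') _ _ _ k12 w3.
rewrite !lk iV -iE !inE !eqxx !orbT => /(_ isT isT)/setP/(_ (c k3')).
case/andP: (third_neq _ _ _ w3) => c31 c32.
by rewrite !inE (negbTE c31) (negbTE c32) eqxx /= => /eqP/cI.
Qed.

Theorem theorem6p4 (R : realType) (T : finType) (C : clutter T)
    (m n : nat) (A : 'M[R]_(m, n)) :
  clutter_matrix C A ->
  minimally_nonideal R C ->
  PG2_incidence 'F_2 (core A) ->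
  m = n.
Proof.
move=> CA [_ minC] /(PG2_fano_labelling CA)[vec vecP].
have H3 : {in hyp C, forall H : {set T}, #|H| = 3%N}.
  move=> H CH; apply/eqP; rewrite eqn_leq; case: (vecP) => _ _ _ -> //.
  rewrite andbT leqNgt; apply/negP=> /(fano_oval_minor vecP R CH).
  by case=> D /minC.
(* Rows correspond to hyperedges and columns to vertices, seven of each. *)
case: CA => r [c [rI rE cI cE _]].
have := card_fano_lines vecP H3; rewrite -rE card_imset // card_ord => ->.
by have := card_fano_vtx vecP; rewrite -cE card_imset // card_ord => ->.
Qed.
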